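(* Let $G$ be a connected undirected weighted graph without self-loops on the node set $\{1,\dots,n\}$, with weighted adjacency matrix $A$ and Laplacian $L$, and let the graph shift operator $S$ be either $S=A$ or $S=L$. Let $\mathcal{H}(S)=\sum_{t=0}^{T-1}h_tS^t$ be a graph filter with frequency response $h(\lambda)=\sum_{t=0}^{T-1}h_t\lambda^t$. Let $x$ be a zero-mean random vector in $\mathbb{R}^n$ with $\mathbb{E}[xx^\top]=I$, and let $\overline{y}=\mathcal{H}(S)x$, with covariance matrix $\mathrm{Cov}(\overline{y})=\mathbb{E}[\overline{y}\,\overline{y}^\top]=\mathcal{H}(S)^2$. If $\mathcal{H}(S)$ is first-order lowpass, then the top eigenvector of $\mathrm{Cov}(\overline{y})$ (the eigenvector for its largest eigenvalue) is, up to sign, a positive vector (all entries strictly positive); moreover, up to scaling, it is the only eigenvector of $\mathrm{Cov}(\overline{y})$ all of whose entries have the same sign.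
   Context: The weighted adjacency matrix $A\in\mathbb{R}^{n\times n}$ of an undirected graph $G=(V,E)$ with $V=\{1,\dots,n\}$ and no self-loops ($(i,i)\notin E$) is a symmetric entrywise nonnegative matrix with $A_{ij}>0$ if and only if $(i,j)\in E$. The Laplacian is $L=\mathrm{Diag}(A\mathbf{1})-A$, where $\mathbf{1}$ is the all-ones vector. The filter coefficients $h_0,\dots,h_{T-1}$ are real numbers. Eigenvalues, counted with multiplicity, are ordered as follows: if $S=L$, then $0=\lambda_1\le\lambda_2\le\dots\le\lambda_n$ are the eigenvalues of $L$; if $S=A$, then $\lambda_1\ge\lambda_2\ge\dots\ge\lambda_n$ are the eigenvalues of $A$. The graph filter $\mathcal{H}(S)$ is first-order lowpass (lowpass with cutoff frequency at $\lambda_1$ and lowpass ratio $\eta_1<1$) if $\max\{|h(\lambda_2)|,\dots,|h(\lambda_n)|\}=\eta_1|h(\lambda_1)|$ with $\eta_1<1$.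
   Formalization: First-order lowpass is taken to include h(λ_1) ≠ 0; without it the zero filter H(S)=0 satisfies the definition, Cov(ȳ)=0, and the claim fails for n ≥ 2. *)

(* Defs.v *)
From mathcomp Require Import all_boot all_order all_algebra.
From mathcomp Require Import all_classical all_reals all_analysis.
Set Implicit Arguments.
Unset Strict Implicit.
Unset Printing Implicit Defensive.
Import Order.TTheory GRing.Theory Num.Theory.
Local Open Scope ring_scope.

(* The node set {1, ..., n} with n >= 1 is rendered as 'I_n.+1, so that ord0 is
   the index 1 of the text. *)

Definition simple_graph (n : nat) (e : rel 'I_n) : Prop :=
  symmetric e /\ irreflexive e.

Definition connected_graph (n : nat) (e : rel 'I_n) : Prop :=
  forall i j : 'I_n, connect e i j.

Definition weighted_adjacency (R : realType) (n : nat) (e : rel 'I_n)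
    (A : 'M[R]_n) : Prop :=
  [/\ A^T = A, forall i j, 0 <= A i j & forall i j, (0 < A i j) = e i j].

Definition laplacian (R : realType) (n : nat) (A : 'M[R]_n) : 'M[R]_n :=
  diag_mx (A *m (const_mx 1 : 'cV[R]_n))^T - A.

Definition graph_filter (R : realType) (n K : nat) (h : 'I_K -> R)
    (S : 'M[R]_n) : 'M[R]_n :=
  \sum_(t < K) h t *: S ^+ t.

Definition frequency_response (R : realType) (K : nat) (h : 'I_K -> R)
    (x : R) : R :=
  \sum_(t < K) h t * x ^+ t.

(* lam lists the eigenvalues of S with (algebraic) multiplicity. *)
Definition eigenvalue_list (R : realType) (n : nat) (S : 'M[R]_n)
    (lam : 'I_n -> R) : Prop :=
  char_poly S = \prod_(i < n) ('X - (lam i)%:P).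

(* The ratio eta only makes sense for a nonzero response at the first
   eigenvalue; without that condition the zero filter would be lowpass.  For a
   one-node graph the maximum is over the empty family and equals 0. *)
Definition first_order_lowpass (R : realType) (n K : nat) (h : 'I_K -> R)
    (lam : 'I_n.+1 -> R) : Prop :=
  frequency_response h (lam ord0) != 0 /\
  exists2 eta : R, eta < 1 &
    \big[Num.max/0]_(i < n.+1 | i != ord0) `|frequency_response h (lam i)|
    = eta * `|frequency_response h (lam ord0)|.

Definition random_vector (d : measure_display) (Omega : measurableType d)
    (R : realType) (n : nat) (x : Omega -> 'cV[R]_n) : Prop :=
  forall i, measurable_fun [set: Omega] (fun w => x w i 0).

(* Entry (i, j) of E[x x^T]. *)
Definition second_moment (d : measure_display) (Omega : measurableType d)
    (R : realType) (P : probability Omega R) (n : nat) (x : Omega -> 'cV[R]_n)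
    (i j : 'I_n) : \bar R :=
  expectation P (fun w => (x w *m (x w)^T) i j).

Definition covariance_entry (d : measure_display) (Omega : measurableType d)
    (R : realType) (P : probability Omega R) (n : nat) (x : Omega -> 'cV[R]_n)
    (i j : 'I_n) : \bar R :=
  covariance P (fun w => x w i 0) (fun w => x w j 0).

(* The entries are truncated to R by fine, which is harmless only when
   covariance_entry is finite. *)
Definition covariance_matrix (d : measure_display) (Omega : measurableType d)
    (R : realType) (P : probability Omega R) (n : nat)
    (x : Omega -> 'cV[R]_n) : 'M[R]_n :=
  \matrix_(i, j) fine (covariance_entry P x i j).

(* Column eigenvectors; eigenvalue and eigenspace in the library act on rows. *)
Definition eigenvector_for (R : realType) (n : nat) (M : 'M[R]_n) (mu : R)
    (v : 'cV[R]_n) : Prop :=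
  v != 0 /\ M *m v = mu *: v.

Definition top_eigenvector (R : realType) (n : nat) (M : 'M[R]_n)
    (v : 'cV[R]_n) : Prop :=
  exists2 mu : R, eigenvector_for M mu v &
    forall nu : R, eigenvalue M nu -> nu <= mu.

(* Zero entries are allowed: "the only eigenvector of one sign" is then the
   stronger claim, and it covers the reading with strict signs. *)
Definition same_sign (R : realType) (n : nat) (v : 'cV[R]_n) : Prop :=
  (forall i, 0 <= v i 0) \/ (forall i, v i 0 <= 0).

(* Main.v *)
(** Since x is white and centered, Cov(y) = H H^T = H^2 with H = h(S).  The shift
    S, or -S when S is the Laplacian, is a symmetric matrix with nonnegative
    off-diagonal entries and connected support: if w maximizes its Rayleigh
    quotient, so does |w|, hence |w| is an eigenvector, positive by connectivity,
    and its eigenvalue is lambda_1.  The lowpass condition says that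
    h^2 - h(lambda_1)^2 vanishes at no lambda_i with i > 1; by Bezout and
    Cayley-Hamilton the top eigenspace of H^2 is then the lambda_1-eigenspace of
    S, a line.  An eigenvector of one sign is not orthogonal to the positive one,
    so by symmetry of H^2 it has the same eigenvalue. *)
Require Import Defs.
From mathcomp Require Import all_boot all_order all_algebra.
From mathcomp Require Import all_classical all_reals all_analysis.
From mathcomp Require Import measurable_realfun ring lra.
Set Implicit Arguments.
Unset Strict Implicit.
Unset Printing Implicit Defensive.
Import Order.TTheory GRing.Theory Num.Theory.
Import numFieldNormedType.Exports.
Local Open Scope ring_scope.

(** * Inner product and maximizers of a quadratic form *)

Section DotProduct.
Context {R : realType} {n : nat}.
Implicit Types (u v w : 'cV[R]_n) (M : 'M[R]_n).

Definition dot u v : R := (u^T *m v) 0 0.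

Lemma dotE u v : dot u v = \sum_i u i 0 * v i 0.
Proof. by rewrite /dot mxE; apply: eq_bigr => i _; rewrite mxE. Qed.

Lemma dotC u v : dot u v = dot v u.
Proof. by rewrite !dotE; apply: eq_bigr => i _; rewrite mulrC. Qed.

Lemma dotDr u v w : dot u (v + w) = dot u v + dot u w.
Proof. by rewrite /dot mulmxDr mxE. Qed.

Lemma dotZr a u v : dot u (a *: v) = a * dot u v.
Proof. by rewrite /dot -scalemxAr mxE. Qed.

Lemma dotDl u v w : dot (v + w) u = dot v u + dot w u.
Proof. by rewrite dotC dotDr !(dotC u). Qed.

Lemma dotZl a u v : dot (a *: v) u = a * dot v u.
Proof. by rewrite dotC dotZr dotC. Qed.

Lemma dot_ge0 u : 0 <= dot u u.
Proof. by rewrite dotE sumr_ge0 // => i _; rewrite -expr2 sqr_ge0. Qed.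

Lemma dot_eq0 u : dot u u = 0 -> u = 0.
Proof.
rewrite dotE => /eqP; rewrite psumr_eq0 => [/allP h|i _]; last first.
  by rewrite -expr2 sqr_ge0.
apply/colP => i; rewrite mxE; apply/eqP.
by have := h i (mem_index_enum _); rewrite /= mulf_eq0 orbb.
Qed.

Lemma dot_gt0 u : u != 0 -> 0 < dot u u.
Proof.
move=> u0; rewrite lt0r dot_ge0 andbT; apply: contra_neq u0; exact: dot_eq0.
Qed.

Lemma dot_mulmx_sym M u v : M^T = M -> dot (M *m u) v = dot u (M *m v).
Proof. by move=> sM; rewrite /dot trmx_mul sM mulmxA. Qed.

Lemma dot_mulmxE M u v : dot u (M *m v) = \sum_i \sum_j u i 0 * M i j * v j 0.
Proof.
rewrite dotE; apply: eq_bigr => i _; rewrite mxE big_distrr /=.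
by apply: eq_bigr => j _; rewrite mulrA.
Qed.

(* If [r = M w - t w] were nonzero, the quadratic form of [t - M], which
   vanishes at [w], would be negative at [w + s r] for the small [s] below. *)
Lemma rayleigh_max_eigenvector M t w : M^T = M ->
  (forall u, dot u (M *m u) <= t * dot u u) ->
  dot w (M *m w) = t * dot w w -> M *m w = t *: w.
Proof.
move=> sM maxM wM.
have [r rE] : {r | r = M *m w - t *: w} by exists (M *m w - t *: w).
apply/eqP; rewrite -subr_eq0 -rE; apply/negPn/negP => r0.
have a_gt0 := dot_gt0 r0; set a := dot r r in a_gt0.
pose q := t * dot r r - dot r (M *m r).
have q_ge0 : 0 <= q by rewrite subr_ge0.
have Mrw : dot r (M *m w) - t * dot r w = a.
  by rewrite /a {4}rE dotDr -(scaleNr t w) dotZr mulNr.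
have Mwr : dot w (M *m r) = dot r (M *m w) by rewrite -(dot_mulmx_sym w r sM) dotC.
(* At [w + s *: r] the form of [t - M] is [s * s * q - 2 * s * a]. This choice gives
   [s * q = a - s], hence the value [- (s * a) - s * s]; the [+ 1] covers [q = 0]. *)
pose s := a / (q + 1).
have sE : s * (q + 1) = a by rewrite /s divfK // gt_eqF // ltr_wpDl.
have s_gt0 : 0 < s by rewrite divr_gt0 // ltr_wpDl.
have := maxM (w + s *: r).
rewrite mulmxDr -scalemxAr !(dotDr, dotDl, dotZr, dotZl) wM Mwr (dotC w r).
have -> : dot r (M *m w) = a + t * dot r w by rewrite -Mrw subrK.
have -> : dot r (M *m r) = t * a - q by rewrite /q /a opprB addrC subrK.
rewrite -/a => {}maxM.
have {sE} sq : s * q = a - s.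
  by move: sE; rewrite (mulrDr s q 1) (mulr1 s) => /(canRL (addrK _)).
have : 0 <= - (s * a) - s * s.
  rewrite -subr_ge0 in maxM; apply: le_trans maxM _.
  rewrite le_eqVlt; apply/orP; left; apply/eqP.
  by rewrite -(subrK (s * (s * q)) (- (s * a) - s * s)) {1}sq; ring.
by apply/negP; rewrite -ltNge -opprD oppr_lt0 addr_gt0 // mulr_gt0.
Qed.

End DotProduct.

(** * Existence of a maximizer of the Rayleigh quotient *)

Section RayleighMaximum.
Context {R : realType}.
Local Open Scope classical_set_scope.

Lemma continuous_sum (T : topologicalType) (I : Type) (r : seq I)
    (f : I -> T -> R) :
  (forall i, continuous (f i)) -> continuous (fun x => \sum_(i <- r) f i x).
Proof.
move=> cf; elim: r => [|i r IHr] x.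
  by under eq_fun do rewrite big_nil; exact: cvg_cst.
under eq_fun do rewrite big_cons.
by apply: cvgD; [exact: cf|exact: IHr].
Qed.

Lemma continuous_dot_mulmx n (M : 'M[R]_n) :
  continuous (fun w : 'rV[R]_n => dot w^T (M *m w^T)).
Proof.
have -> : (fun w : 'rV[R]_n => dot w^T (M *m w^T)) =
    (fun w : 'rV[R]_n => \sum_i \sum_j w 0 i * M i j * w 0 j).
  apply/funext => w; rewrite dot_mulmxE; apply: eq_bigr => i _.
  by apply: eq_bigr => j _; rewrite !mxE.
apply: continuous_sum => i; apply: continuous_sum => j w.
have c k : {for w, continuous (fun w : 'rV[R]_n => w 0 k)}.
  exact: coord_continuous.
apply: (continuousM (s := fun w : 'rV[R]_n => w 0 i * M i j)) (c j).
by apply: (continuousM (t := fun=> M i j)) (c i) _; exact: cst_continuous.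
Qed.

(** The quadratic form is continuous on the compact unit sphere; homogeneity carries the bound from
    unit vectors to all vectors. *)
Lemma rayleigh_attained n (M : 'M[R]_n.+1) :
  exists t : R, exists2 w : 'cV[R]_n.+1, w != 0 &
    dot w (M *m w) = t * dot w w /\
    forall u, dot u (M *m u) <= t * dot u u.
Proof.
pose A := [set w : 'rV[R]_n.+1 | dot w^T w^T = 1].
have A0 : A !=set0.
  exists (delta_mx 0 0); rewrite /A /= dotE (bigD1 ord0) //= !mxE !eqxx mulr1.
  by rewrite big1 ?addr0 // => i /negPf i0; rewrite !mxE i0 andbF mul0r.
have cA : compact A.
  apply: bounded_closed_compact.
    exists 1; split; first exact: num_real.
    move=> N N1 w /=; rewrite /A /= => w1.
    rewrite [leLHS]/Num.norm /= mx_normrE; apply/bigmax_leP; split; first by lra.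
    move=> [i j] _ /=; rewrite ord1 {i}; apply: le_trans (ltW N1).
    rewrite -(@ler_pXn2r _ 2) ?nnegrE // expr1n -w1 dotE (bigD1 j) //=.
    rewrite !mxE -expr2 real_normK ?num_real // lerDl sumr_ge0 // => i _.
    by rewrite -expr2 sqr_ge0.
  (* The sphere is a level set of the quadratic form of the identity, so the same continuity lemma
     shows that it is closed. *)
  have -> : A = (fun w : 'rV[R]_n.+1 => dot w^T (1%:M *m w^T)) @^-1` [set 1].
    by apply/seteqP; split => w /=; rewrite /A /= mul1mx.
  by apply: closed_comp; [move=> w _; exact: continuous_dot_mulmx|exact: closed_eq].
have cf : {within A, continuous (fun w : 'rV[R]_n.+1 => dot w^T (M *m w^T))}.
  exact/continuous_subspaceT/continuous_dot_mulmx.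
have [w /set_mem wA maxw] := compact_EVT_max A0 cA cf.
exists (dot w^T (M *m w^T)), w^T.
  apply/eqP => w0; move: wA; rewrite /A /= w0 dotE big1 ?(@ltr01 R) => [/eqP|i _].
    by rewrite eq_sym oner_eq0.
  by rewrite mxE mul0r.
split=> [|u]; first by rewrite (wA : _ = 1) mulr1.
have [->|u0] := eqVneq u 0; first by rewrite mulmx0 /dot mulmx0 mxE mulr0.
have uu := dot_gt0 u0; pose k := Num.sqrt (dot u u).
have kE : k * k = dot u u by rewrite -expr2 sqr_sqrtr // ltW.
have k0 : k != 0 by rewrite gt_eqF // sqrtr_gt0.
have /maxw : (k^-1 *: u)^T \in A.
  by apply/mem_set; rewrite /A /= trmxK dotZl dotZr -kE; field.
rewrite trmxK -scalemxAr dotZl dotZr mulrA -invfM kE mulrC ler_pdivrMr //.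
Qed.

End RayleighMaximum.

(** * Perron theory for symmetric matrices with connected support *)

Section Perron.
Context {R : realType} {n : nat}.
Variables (e : rel 'I_n.+1) (M : 'M[R]_n.+1).
Hypothesis e_connected : connected_graph e.
Hypothesis M_ge0 : forall i j, i != j -> 0 <= M i j.
Hypothesis M_gt0 : forall i j, i != j -> e i j -> 0 < M i j.

(** Where [v] vanishes, the eigenvalue equation is a vanishing sum of nonnegative terms, so [v]
    vanishes at all neighbours, and connectivity spreads the zero. The diagonal of [M] may have any
    sign: its entry meets a zero of [v]. *)
Lemma nonneg_eigenvector_eq0 t (v : 'cV[R]_n.+1) i :
  (forall j, 0 <= v j 0) -> M *m v = t *: v -> v i 0 = 0 -> v = 0.
Proof.
move=> v_ge0 vM.
have step j k : e j k -> v j 0 = 0 -> v k 0 = 0.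
  have [-> //|kj] := eqVneq k j; move=> ejk vj0.
  have /eqP := congr1 (fun w : 'cV_n.+1 => w j 0) vM.
  rewrite !mxE vj0 mulr0 psumr_eq0 => [/allP/(_ k (mem_index_enum _))|l _].
    by rewrite /= mulf_eq0 gt_eqF ?M_gt0 1?eq_sym //= => /eqP.
  have [->|lj] := eqVneq l j; first by rewrite vj0 mulr0.
  by rewrite mulr_ge0 // M_ge0 // eq_sym.
move=> vi0; apply/colP => j; rewrite [RHS]mxE.
have /connectP[p ep ->] := e_connected i j.
elim: p i vi0 ep => //= k p IHp i vi0 /andP[eik ekp].
by apply: IHp => //; exact: step vi0.
Qed.

Lemma nonneg_eigenvector_gt0 t (v : 'cV[R]_n.+1) :
  v != 0 -> (forall j, 0 <= v j 0) -> M *m v = t *: v -> forall i, 0 < v i 0.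
Proof.
move=> v0 v_ge0 vM i; rewrite lt0r v_ge0 andbT.
by apply: contra_neq v0; exact: nonneg_eigenvector_eq0 vM.
Qed.

(* Subtract from [u] the largest multiple of [v] that keeps it nonnegative. *)
Lemma positive_eigenvector_simple t (u v : 'cV[R]_n.+1) :
  (forall j, 0 < v j 0) -> M *m v = t *: v -> M *m u = t *: u ->
  exists c, u = c *: v.
Proof.
move=> v_gt0 vM uM.
have [i _ min_i] : extremum_spec <=%O predT (fun j => u j 0 / v j 0)
    (Order.arg_min ord0 predT (fun j => u j 0 / v j 0)) by exact: arg_minP.
exists (u i 0 / v i 0); apply/eqP; rewrite -subr_eq0; apply/eqP.
apply: (@nonneg_eigenvector_eq0 t _ i) => [j||].
- by rewrite !mxE subr_ge0 -ler_pdivlMr // min_i.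
- by rewrite mulmxBr -scalemxAr vM uM scalerBr !scalerA mulrC.
- by rewrite !mxE divfK ?subrr // gt_eqF.
Qed.

(** Off the diagonal, absolute values can only increase a term; a diagonal entry, possibly negative,
    multiplies a square, which does not change. *)
Lemma dot_mulmx_abs_le (w : 'cV[R]_n.+1) :
  dot w (M *m w) <= dot (map_mx Num.norm w) (M *m map_mx Num.norm w).
Proof.
rewrite !dot_mulmxE; apply: ler_sum => i _; apply: ler_sum => j _.
rewrite !mxE; have [<-|ij] := eqVneq i j.
  by rewrite mulrAC -expr2 [leRHS]mulrAC -expr2 real_normK ?num_real.
apply: le_trans (ler_norm _) _.
by rewrite !normrM (ger0_norm (M_ge0 ij)).
Qed.

Lemma perron_symmetric : M^T = M ->
  exists t, exists v : 'cV[R]_n.+1,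
    [/\ forall i, 0 < v i 0, M *m v = t *: v &
        forall s (u : 'cV[R]_n.+1), u != 0 -> M *m u = s *: u -> s <= t].
Proof.
move=> sM; have [t [w w0 [wt maxt]]] := rayleigh_attained M.
pose v := map_mx Num.norm w.
have v0 : v != 0.
  apply: contra_neq w0 => v0; apply/colP => i; rewrite [RHS]mxE; apply/eqP.
  by have := congr1 (fun z : 'cV_n.+1 => z i 0) v0; rewrite !mxE => /normr0P.
have vv : dot v v = dot w w.
  rewrite !dotE; apply: eq_bigr => i _.
  by rewrite !mxE -!expr2 real_normK ?num_real.
have vM : M *m v = t *: v.
  apply: rayleigh_max_eigenvector => //; apply/eqP; rewrite eq_le maxt /=.
  by rewrite vv -wt dot_mulmx_abs_le.
exists t, v; split=> //.
  by apply: nonneg_eigenvector_gt0 vM => // j; rewrite mxE normr_ge0.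
move=> s u u0 uM; have := maxt u.
by rewrite uM dotZr ler_pM2r // dot_gt0.
Qed.

End Perron.

(** * Kernels of polynomials in a matrix *)

Section MatrixPolynomial.
Context {F : fieldType} {n : nat}.
Implicit Types (S : 'M[F]_n.+1) (p q : {poly F}) (u v : 'cV[F]_n.+1).

Lemma horner_mx_eigenvector S a v p :
  S *m v = a *: v -> horner_mx S p *m v = p.[a] *: v.
Proof.
move=> vS; elim/poly_ind: p => [|p c IHp].
  by rewrite rmorph0 mul0mx horner0 scale0r.
rewrite rmorphD rmorphM /= horner_mx_X horner_mx_C hornerMXaddC.
rewrite mulmxDl -mulmxE -mulmxA vS -scalemxAr IHp mul_scalar_mx scalerA.
by rewrite -scalerDl mulrC.
Qed.

(** Evaluate a Bezout relation [a * p + b * q = 1] at [S] and apply it to [u]. *)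
Lemma coprimep_horner_mx_eq0 S p q u :
  coprimep p q -> horner_mx S p *m u = 0 -> horner_mx S q *m u = 0 -> u = 0.
Proof.
move=> /Bezout_eq1_coprimepP[[a b] /= ab1] pu qu.
have h1 : horner_mx S 1 = 1%:M by rewrite rmorph1.
rewrite -[u]mul1mx -h1 -ab1 rmorphD !rmorphM /=.
by rewrite mulmxDl -!mulmxE -!mulmxA pu qu !mulmx0 addr0.
Qed.

Lemma trmx_horner_mx S p : S^T = S -> (horner_mx S p)^T = horner_mx S p.
Proof.
move=> sS; elim/poly_ind: p => [|p c IHp].
  by rewrite rmorph0 trmx0.
rewrite rmorphD rmorphM /= horner_mx_X horner_mx_C linearD /= tr_scalar_mx.
rewrite -mulmxE trmx_mul sS IHp; congr (_ + _).
(* Transposition has swapped the two factors; both are polynomials in [S], so they commute. *)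
by rewrite !mulmxE -{1 4}(horner_mx_X S) -!rmorphM mulrC.
Qed.

Lemma coprimep_prod_XsubC (I : finType) (P : pred I) (a : I -> F) q :
  (forall i, P i -> ~~ root q (a i)) ->
  coprimep q (\prod_(i | P i) ('X - (a i)%:P)).
Proof.
move=> qP; elim/big_ind: _ => [|p1 p2 c1 c2|i Pi]; first exact: coprimep1.
  by rewrite coprimepMr c1.
by rewrite coprimep_XsubC qP.
Qed.

Section SplitCharPoly.
Variables (S : 'M[F]_n.+1) (a : 'I_n.+1 -> F).
Hypothesis charS : char_poly S = \prod_(i < n.+1) ('X - (a i)%:P).

(** Otherwise [q] would be coprime to the characteristic polynomial, which kills [u] too by
    Cayley-Hamilton. With [q] of the form [p - mu%:P] this locates the eigenvalues of
    [horner_mx S p]. *)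
Lemma horner_mx_singular_root q u :
  u != 0 -> horner_mx S q *m u = 0 -> exists i, root q (a i).
Proof.
move=> u0 qu; apply/existsP; apply: contraNT u0 => /existsPn qa.
have /coprimep_horner_mx_eq0 cop : coprimep q (char_poly S).
  by rewrite charS; apply: coprimep_prod_XsubC => i _; exact: qa.
by apply/eqP/(cop _ _ qu); rewrite Cayley_Hamilton mul0mx.
Qed.

(** Factor the characteristic polynomial as [l * r] with [l] the factor at [a ord0]. The image of
    [u] under [l] is killed by [q] and, by Cayley-Hamilton, by the coprime [r], so it is zero. *)
Lemma horner_mx_simple_root q u :
  (forall i, i != ord0 -> ~~ root q (a i)) -> horner_mx S q *m u = 0 ->
  S *m u = a ord0 *: u.
Proof.
move=> qa qu; pose r := \prod_(i < n.+1 | i != ord0) ('X - (a i)%:P).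
pose l := 'X - (a ord0)%:P.
have cop : coprimep q r by exact: coprimep_prod_XsubC.
have lE : horner_mx S l *m u = S *m u - a ord0 *: u.
  by rewrite rmorphB /= horner_mx_X horner_mx_C mulmxBl mul_scalar_mx.
apply/eqP; rewrite -subr_eq0 -lE; apply/eqP.
apply: (@coprimep_horner_mx_eq0 S _ _ _ cop).
  by rewrite mulmxA mulmxE -rmorphM mulrC rmorphM -mulmxE -mulmxA qu mulmx0.
have -> : horner_mx S r *m (horner_mx S l *m u) = horner_mx S (char_poly S) *m u.
  by rewrite mulmxA mulmxE -rmorphM mulrC charS [in RHS](bigD1 ord0).
by rewrite Cayley_Hamilton mul0mx.
Qed.

End SplitCharPoly.
End MatrixPolynomial.

(** * Moments of linear images of a random vector *)

Section RandomVectors.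
Context {d : measure_display} {Omega : measurableType d} {R : realType}.
Variable P : probability Omega R.

(** A finite integral forces finite positive and negative parts, since [+oo - +oo] is not finite.
    Integrability thus comes from the moment values alone. *)
Lemma integrable_expectation_fin_num (f : Omega -> R) :
  measurable_fun [set: Omega] f -> expectation P f \is a fin_num ->
  P.-integrable [set: Omega] (EFin \o f).
Proof.
move=> mf; rewrite unlock -integral_fin_num_abs // => f_fin.
by apply/integrableP; split=> //; exact/measurable_EFinP.
Qed.

Lemma expectation_lincomb (I : finType) (a : I -> R) (f : I -> Omega -> R)
    (r : I -> R) :
  (forall i, measurable_fun [set: Omega] (f i)) ->
  (forall i, expectation P (f i) = (r i)%:E) ->
  expectation P (fun w => \sum_i a i * f i w) = (\sum_i a i * r i)%:E.
Proof.
move=> mf fr.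
have intf i : P.-integrable [set: Omega] (EFin \o f i).
  by apply: integrable_expectation_fin_num; rewrite ?fr.
rewrite unlock.
under eq_integral do rewrite -sumEFin.
rewrite integral_sum //=; last first.
  by move=> i; exact: (integrableZl measurableT (a i) (intf i)).
rewrite -sumEFin; apply: eq_bigr => i _.
by rewrite EFinM -fr unlock; exact: (integralZl measurableT (intf i)).
Qed.

Context {n : nat}.
Implicit Types (x : Omega -> 'cV[R]_n) (H : 'M[R]_n).

Lemma centered_covariance_entry x i j :
  (forall i, expectation P (fun w => x w i 0) = 0%:E) ->
  covariance_entry P x i j = second_moment P x i j.
Proof.
move=> x0; rewrite /covariance_entry /second_moment unlock !x0 /=.
congr expectation; apply/funext => w; rewrite mxE big_ord1 !mxE.
by rewrite [LHS]/GRing.mul /= !subr0.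
Qed.

Lemma centered_mulmx x H i :
  random_vector x -> (forall i, expectation P (fun w => x w i 0) = 0%:E) ->
  expectation P (fun w => (H *m x w) i 0) = 0%:E.
Proof.
move=> mx x0; under eq_fun do rewrite mxE.
rewrite (expectation_lincomb _ mx x0) big1 // => k _; exact: mulr0.
Qed.

Lemma white_second_moment x H i j :
  random_vector x ->
  (forall i j, second_moment P x i j = ((1%:M : 'M[R]_n) i j)%:E) ->
  second_moment P (fun w => H *m x w) i j = ((H *m H^T) i j)%:E.
Proof.
move=> mx x1; rewrite /second_moment.
(* Indexing the products by pairs turns the double sum into one linear combination, whose moments
   are the entries of the identity. *)
pose f (kl : 'I_n * 'I_n) w := x w kl.1 0 * x w kl.2 0.
have fE : (fun w => ((H *m x w) *m (H *m x w)^T) i j) =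
    fun w => \sum_kl H i kl.1 * H j kl.2 * f kl w.
  apply/funext => w; rewrite mxE big_ord1 !mxE big_distrlr /= pair_big /=.
  by apply: eq_bigr => kl _; rewrite /f; ring.
rewrite fE (@expectation_lincomb _ _ _ (fun kl => (1%:M : 'M[R]_n) kl.1 kl.2)).
- congr EFin.
  rewrite -(pair_bigA _ (fun k l => H i k * H j l * (1%:M : 'M[R]_n) k l)) /=.
  rewrite mxE; apply: eq_bigr => k _; rewrite (bigD1 k) //= big1 => [|l lk].
    by rewrite !mxE eqxx mulr1 addr0.
  by rewrite mxE eq_sym (negPf lk) mulr0.
- by move=> kl; exact: measurable_funM.
- move=> kl; rewrite -x1 /second_moment; congr expectation; apply/funext => w.
  by rewrite mxE big_ord1 !mxE.
Qed.

End RandomVectors.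

(** * Graph filters and their frequency response *)

Definition response_poly (R : realType) (K : nat) (h : 'I_K -> R) : {poly R} :=
  \sum_(t < K) h t *: 'X^t.

Lemma horner_response_poly (R : realType) (K : nat) (h : 'I_K -> R) (a : R) :
  (response_poly h).[a] = frequency_response h a.
Proof.
by rewrite horner_sum; apply: eq_bigr => t _; rewrite hornerZ hornerXn.
Qed.

(** Filter and frequency response become values of one polynomial, at [S] and at a scalar, so the
    kernel lemmas above apply to the filter. *)
Lemma horner_mx_response_poly (R : realType) (n K : nat) (h : 'I_K -> R)
    (S : 'M[R]_n.+1) :
  horner_mx S (response_poly h) = graph_filter h S.
Proof.
rewrite rmorph_sum; apply: eq_bigr => t _ /=.
by rewrite horner_mxZ rmorphXn /= horner_mx_X.
Qed.

(** The maximum bounds each response by [eta] times the first one; strictness comes from [eta < 1]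
    and the first response being nonzero. *)
Lemma first_order_lowpass_lt (R : realType) (n K : nat) (h : 'I_K -> R)
    (lam : 'I_n.+1 -> R) i :
  first_order_lowpass h lam -> i != ord0 ->
  `|frequency_response h (lam i)| < `|frequency_response h (lam ord0)|.
Proof.
move=> [h0 [eta eta1 maxE]] i0.
apply: (@le_lt_trans _ _ (eta * `|frequency_response h (lam ord0)|)).
  rewrite -maxE.
  exact: (le_bigmax_cond 0 (fun j => `|frequency_response h (lam j)|)).
by rewrite gtr_pMl // normr_gt0.
Qed.

(* [A] and [- laplacian A] both have nonnegative off-diagonal entries, so
   one Perron argument covers both shifts. *)
Lemma graph_shift_perron (R : realType) (n : nat) (e : rel 'I_n.+1)
    (A S : 'M[R]_n.+1) (lam : 'I_n.+1 -> R) :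
  connected_graph e -> weighted_adjacency e A -> eigenvalue_list S lam ->
  (S = A /\ forall i j : 'I_n.+1, (i <= j)%N -> lam j <= lam i) \/
  (S = laplacian A /\ forall i j : 'I_n.+1, (i <= j)%N -> lam i <= lam j) ->
  S^T = S /\
  exists v : 'cV[R]_n.+1,
    [/\ forall i, 0 < v i 0, S *m v = lam ord0 *: v &
        forall u, S *m u = lam ord0 *: u -> exists c, u = c *: v].
Proof.
move=> conn [sA A_ge0 A_gt0] lamS SE.
(* [eigenvalue] provides row vectors, hence the transpose of [S] here. *)
have eigS i : exists2 u : 'cV[R]_n.+1, u != 0 & S^T *m u = lam i *: u.
  have : eigenvalue S (lam i).
    rewrite eigenvalue_root_char lamS; apply/rootP.
    by rewrite horner_prod (bigD1 i) //= hornerXsubC subrr mul0r.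
  move=> /eigenvalueP[u uS u0]; exists u^T; rewrite ?trmx_eq0 //.
  by rewrite -trmx_mul uS linearZ.
have rootS s (v : 'cV[R]_n.+1) : v != 0 -> S *m v = s *: v -> exists i, s = lam i.
  move=> v0 vS; have [|i] := horner_mx_singular_root lamS (q := 'X - s%:P) v0.
    by rewrite (horner_mx_eigenvector _ vS) hornerXsubC subrr scale0r.
  by rewrite root_XsubC => /eqP <-; exists i.
have nz (v : 'cV[R]_n.+1) : (forall i, 0 < v i 0) -> v != 0.
  by move=> /(_ ord0); apply: contraTneq => ->; rewrite mxE ltxx.
case: SE => -[SE lamle]; subst S.
  split=> //.
  have M_ge0 i j : i != j -> 0 <= A i j by [].
  have M_gt0 i j : i != j -> e i j -> 0 < A i j by rewrite A_gt0.
  have [t [v [v_gt0 vA maxt]]] := perron_symmetric conn M_ge0 M_gt0 sA.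
  (* [t] is some [lam i], so at most [lam ord0]; conversely [lam ord0] is an eigenvalue, so at most
     [t]. *)
  have tE : t = lam ord0.
    have [i ti] := rootS _ _ (nz _ v_gt0) vA.
    have [u u0 uA] := eigS ord0; rewrite sA in uA.
    by apply/le_anti; rewrite (maxt _ _ u0 uA) ti lamle.
  exists v; split; rewrite -?tE // => u uA.
  exact: (positive_eigenvector_simple conn M_ge0 M_gt0 v_gt0 vA uA).
have sL : (laplacian A)^T = laplacian A.
  by rewrite /laplacian linearB /= tr_diag_mx sA.
split=> //; rewrite sL in eigS.
have LE i j : i != j -> (- laplacian A) i j = A i j.
  by move=> ij; rewrite !mxE (negPf ij) mulr0n sub0r opprK.
have M_ge0 i j : i != j -> 0 <= (- laplacian A) i j by move=> /LE->.
have M_gt0 i j : i != j -> e i j -> 0 < (- laplacian A) i j.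
  by move=> /LE->; rewrite A_gt0.
have sNL : (- laplacian A)^T = - laplacian A by rewrite linearN /= sL.
have [t [v [v_gt0 vL maxt]]] := perron_symmetric conn M_ge0 M_gt0 sNL.
have NL (u : 'cV[R]_n.+1) s :
    laplacian A *m u = s *: u -> - laplacian A *m u = - s *: u.
  by move=> uL; rewrite mulNmx uL scaleNr.
have vL' : laplacian A *m v = - t *: v by rewrite scaleNr -vL mulNmx opprK.
(* The largest eigenvalue of [- laplacian A] is minus the least one of [laplacian A], which the
   increasing order puts first. *)
have tE : - t = lam ord0.
  have [i ti] := rootS _ _ (nz _ v_gt0) vL'.
  have [u u0 /NL/(maxt _ _ u0)] := eigS ord0.
  by rewrite lerNl => le1; apply/le_anti; rewrite le1 ti lamle.
exists v; split; rewrite -?tE // => u /NL; rewrite opprK => uL.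
exact: (positive_eigenvector_simple conn M_ge0 M_gt0 v_gt0 vL uL).
Qed.

(** * Top eigenvector of the covariance of the filtered signal *)

Theorem mainTheorem1 (R : realType) (n : nat) (e : rel 'I_n.+1)
    (A : 'M[R]_n.+1) (S : 'M[R]_n.+1) (lam : 'I_n.+1 -> R)
    (K : nat) (h : 'I_K -> R)
    (d : measure_display) (Omega : measurableType d) (P : probability Omega R)
    (x y : Omega -> 'cV[R]_n.+1)
    (he : simple_graph e) (hconn : connected_graph e)
    (hA : weighted_adjacency e A)
    (hlam : eigenvalue_list S lam)
    (hS : (S = A /\ forall i j : 'I_n.+1, (i <= j)%N -> lam j <= lam i) \/
          (S = laplacian A /\ forall i j : 'I_n.+1, (i <= j)%N -> lam i <= lam j))
    (hx : random_vector x)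
    (hx0 : forall i, expectation P (fun w => x w i 0) = 0%:E)
    (hx1 : forall i j, second_moment P x i j = ((1%:M : 'M[R]_n.+1) i j)%:E)
    (hy : forall w, y w = graph_filter h S *m x w)
    (hlow : first_order_lowpass h lam) :
  [/\ forall i j, covariance_entry P y i j = second_moment P y i j,
      forall i j, second_moment P y i j = ((graph_filter h S ^+ 2) i j)%:E
    & exists v : 'cV[R]_n.+1,
        [/\ top_eigenvector (covariance_matrix P y) v,
            forall i, 0 < v i 0,
            forall u, top_eigenvector (covariance_matrix P y) u ->
              exists c : R, u = c *: v
          & forall mu u, eigenvector_for (covariance_matrix P y) mu u ->
              same_sign u -> exists c : R, u = c *: v]].
Proof.
have [sS [v [v_gt0 vS simple_v]]] := graph_shift_perron hconn hA hlam hS.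
have {hy} -> : y = fun w => graph_filter h S *m x w by exact/funext.
set H := graph_filter h S; set z := fun w => H *m x w.
pose p := response_poly h.
have HE : H = horner_mx S p by rewrite horner_mx_response_poly.
have sH : H^T = H by rewrite HE trmx_horner_mx.
have covE i j : covariance_entry P z i j = second_moment P z i j.
  by apply: centered_covariance_entry => k; exact: centered_mulmx.
have momE i j : second_moment P z i j = ((H ^+ 2) i j)%:E.
  by rewrite white_second_moment // sH expr2 mulmxE.
(* By [covE] and [momE] every entry is finite, so [fine] loses nothing. *)
split=> //; have -> : covariance_matrix P z = H ^+ 2.
  by apply/matrixP => i j; rewrite mxE covE momE.
have H2E : H ^+ 2 = horner_mx S (p ^+ 2) by rewrite rmorphXn HE.
pose top := (p ^+ 2).[lam ord0].
have p2E a : (p ^+ 2).[a] = `|frequency_response h a| ^+ 2.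
  by rewrite horner_exp horner_response_poly real_normK ?num_real.
have p2_lt i : i != ord0 -> (p ^+ 2).[lam i] < top.
  by move=> i0; rewrite /top !p2E ltr_pXn2r ?nnegrE // first_order_lowpass_lt.
have sH2 : (H ^+ 2)^T = H ^+ 2 by rewrite expr2 -mulmxE trmx_mul sH.
have vtop : H ^+ 2 *m v = top *: v by rewrite H2E (horner_mx_eigenvector _ vS).
have v0 : v != 0.
  by move: (v_gt0 ord0); apply: contraTneq => ->; rewrite mxE ltxx.
have polyE mu u : H ^+ 2 *m u = mu *: u -> horner_mx S (p ^+ 2 - mu%:P) *m u = 0.
  by move=> uH; rewrite rmorphB /= horner_mx_C mulmxBl -H2E uH mul_scalar_mx subrr.
(* [p ^+ 2 - top%:P] has no root at any [lam i] with [i != ord0], so [u] is an eigenvector of [S]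
   for [lam ord0]. *)
have simple_top u : H ^+ 2 *m u = top *: u -> exists c, u = c *: v.
  move=> /polyE uH; apply/simple_v/(horner_mx_simple_root hlam _ uH) => i i0.
  by rewrite rootE hornerD hornerN hornerC subr_eq0 lt_eqF // p2_lt.
have eig_le mu (u : 'cV[R]_n.+1) : u != 0 -> H ^+ 2 *m u = mu *: u -> mu <= top.
  move=> u0 /polyE /(horner_mx_singular_root hlam u0)[i].
  rewrite rootE hornerD hornerN hornerC subr_eq0 => /eqP <-.
  by have [->//|i0] := eqVneq i ord0; rewrite ltW // p2_lt.
have row_eig_le mu : eigenvalue (H ^+ 2) mu -> mu <= top.
  move=> /eigenvalueP[u uH u0]; apply: (eig_le mu u^T); rewrite ?trmx_eq0 //.
  by rewrite -{1}sH2 -trmx_mul uH linearZ.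
exists v; split=> //.
- by exists top.
- move=> u [mu [u0 uH] mu_max]; apply: simple_top.
  rewrite uH; congr (_ *: _); apply/le_anti; rewrite (eig_le _ _ u0 uH) /=.
  apply: mu_max; apply/eigenvalueP; exists v^T; rewrite ?trmx_eq0 //.
  by rewrite -{1}sH2 -trmx_mul vtop linearZ.
- move=> mu u [u0 uH] u_sign.
  have [i ui0] : exists i, u i 0 != 0 by apply/cV0Pn.
  (* All terms of the inner product have one sign, and the term at [i] is nonzero. *)
  have uv0 : dot u v != 0.
    rewrite dotE; case: u_sign => u_sign.
      rewrite psumr_neq0 => [|k _]; last by rewrite mulr_ge0 // ltW.
      apply/hasP; exists i; rewrite ?mem_index_enum //=.
      by rewrite mulr_gt0 // lt0r ui0 u_sign.
    rewrite -oppr_eq0 -sumrN psumr_neq0 => [|k _]; last first.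
      by rewrite -mulNr mulr_ge0 ?oppr_ge0 // ltW.
    apply/hasP; exists i; rewrite ?mem_index_enum //=.
    by rewrite -mulNr mulr_gt0 // oppr_gt0 lt_neqAle ui0 u_sign.
  apply: simple_top; rewrite uH; congr (_ *: _).
  (* Moving the symmetric [H ^+ 2] across the inner product gives [mu * dot u v = top * dot u v];
     cancel [dot u v]. *)
  apply: (mulIf uv0); rewrite -dotZl -uH dot_mulmx_sym //.
  by rewrite vtop dotZr.
Qed.
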